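(* Let $\varphi=(1+\sqrt5)/2$. For $W_0=\mathbb{N}$, the survivor sequence $(s_n)$ and deletion sequence $(d_n)$ of the golden sieve satisfy $$s_n=\lfloor (n-1)\varphi\rfloor+2\quad(n\ge1),\qquad d_n=\lfloor (n-1)\varphi^2\rfloor+2\quad(n\ge2),$$ and $d_1=1$. Setting $A_m:=s_{m+1}-2$ and $B_m:=d_{m+1}-2$ for $m\ge1$ gives the classical Wythoff pair: $A_m=\lfloor m\varphi\rfloor$, $B_m=\lfloor m\varphi^2\rfloor$, and $B_m=A_m+m$. The sequence $(d_n)_{n\ge1}$ coincides with the $(0,1,2,3)$-hiccup sequence (OEIS A007066).
   Context: $\mathbb{N}=\{1,2,3,\ldots\}$. For a strictly increasing sequence $X$ of positive integers, $X(k)$ denotes its $k$-th term. Golden sieve: let $W_0=(w_1<w_2<\cdots)$ be an infinite strictly increasing sequence of positive integers. For $n\ge1$ define inductively $h_n:=W_{n-1}(n)$ (the pointer), $d_n:=W_{n-1}(h_n)$ (the deletion), and let $W_n$ be the increasing sequence obtained from $W_{n-1}$ by removing the value $d_n$. The survivor sequence $(s_n)_{n\ge1}$ is the increasing enumeration of $W_0\setminus\{d_1,d_2,\ldots\}$. The $(0,1,2,3)$-hiccup sequence is the increasing sequence $(x_n)_{n\ge1}$ with $x_1=1$ and, for $n\ge2$, $x_n-x_{n-1}=2$ if $n\in\{x_1,\ldots,x_{n-1}\}$ and $x_n-x_{n-1}=3$ otherwise. *)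

(* Defs.v *)
From mathcomp Require Import all_boot all_order all_algebra.
From mathcomp Require Import all_classical all_reals.
From mathcomp Require Import zify.

Set Implicit Arguments.
Unset Strict Implicit.
Unset Printing Implicit Defensive.

Import Order.TTheory GRing.Theory Num.Theory.

Local Open Scope classical_set_scope.

(** Sequences of positive integers are functions [X : nat -> nat] whose terms
    are [X 1], [X 2], ...; the index 0 does not count as a term.  For increasing
    sequences the convention [X 0 = 0] makes strict monotonicity on the whole of
    [nat] equivalent to strict monotonicity and positivity of the terms. *)

Definition terms (X : nat -> nat) : set nat := [set X k | k in [set k | 0 < k]].

Definition increasing_enumeration (P : set nat) (X : nat -> nat) : Prop :=
  [/\ X 0 = 0, {homo X : i j / i < j} & terms X = P].

Lemma increasing_enumeration_unique P X Y :
  increasing_enumeration P X -> increasing_enumeration P Y -> X = Y.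
Proof.
have le X' Y' : increasing_enumeration P X' -> increasing_enumeration P Y' ->
    forall n, X' n <= Y' n.
  move=> [X0 Xlt XP] [Y0 Ylt YP]; elim=> [|n IH]; first by rewrite X0.
  have : terms X' (Y' n.+1) by rewrite XP -YP; exists n.+1.
  case=> k _ Xk; rewrite -Xk (leq_mono Xlt) -(leqW_mono (leq_mono Xlt)) Xk.
  exact: leq_ltn_trans IH (Ylt _ _ (ltnSn n)).
move=> PX PY; apply/funext => n; apply/eqP.
by rewrite eqn_leq !le.
Qed.

(** The constant 0, which is not an increasing sequence, is returned when [P]
    has no increasing enumeration (i.e. is finite or contains 0). *)
Definition enumeration (P : set nat) : nat -> nat :=
  xget (fun=> 0) [set X | increasing_enumeration P X].

Lemma enumerationE P X : increasing_enumeration P X -> enumeration P = X.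
Proof.
move=> PX; apply: (increasing_enumeration_unique (P := P)) => //.
exact: (xgetI (fun=> 0) (P := [set X | increasing_enumeration P X]) PX).
Qed.

(** [sieve W0 n] is the sequence W_n. *)
Fixpoint sieve (W0 : nat -> nat) (n : nat) : nat -> nat :=
  if n is m.+1 then
    let W := sieve W0 m in enumeration (terms W `\ W (W m.+1))
  else W0.

(** Both are meaningful for [1 <= n] only. *)
Definition pointer (W0 : nat -> nat) (n : nat) : nat := sieve W0 n.-1 n.
Definition deletion (W0 : nat -> nat) (n : nat) : nat :=
  sieve W0 n.-1 (pointer W0 n).

Definition survivor (W0 : nat -> nat) : nat -> nat :=
  enumeration (terms W0 `\` terms (deletion W0)).

(** The sequence 1, 2, 3, ... *)
Definition naturals : nat -> nat := id.

Definition hiccup0123 (x : nat -> nat) : Prop :=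
  x 1 = 1 /\
  forall n, 2 <= n ->
    x n = x n.-1 + (if n \in [seq x k | k <- iota 1 n.-1] then 2 else 3).

Lemma hiccup0123_unique x y :
  hiccup0123 x -> hiccup0123 y -> forall n, 1 <= n -> x n = y n.
Proof.
move=> [x1 xS] [y1 yS]; elim/ltn_ind=> -[|[|n]] // IH _; first by rewrite x1 y1.
rewrite xS // yS //= IH //.
suff -> : [seq x k | k <- iota 2 n] = [seq y k | k <- iota 2 n] by rewrite x1 y1.
by apply/eq_in_map => k; rewrite mem_iota => /andP[k2 kn]; apply: IH; lia.
Qed.

Local Open Scope ring_scope.

Definition golden_ratio (R : realType) : R := (1 + Num.sqrt 5) / 2.

(* Main.v *)
Require Import Defs.
From mathcomp Require Import all_boot all_order all_algebra.
From mathcomp Require Import all_classical all_reals.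
From mathcomp Require Import zify ring lra.

(** Put s_0 = 0 and s_n = floor ((n - 1) phi) + 2 for n >= 1.  Since
    phi - 1 = 1 / phi and phi is irrational, this sequence satisfies the
    self-referential rule s_k = k + m whenever s_m <= k < s_{m+1} and m >= 1.
    From that rule alone, induction on n shows that W_n agrees with s at the
    indices below s_n and is k |-> k + n from there on.  Hence the pointer at
    step n + 1 >= 2 is s_{n+1}, the deletion is s_{n+1} + n, and the numbers
    that are never deleted are exactly the terms of s.  By the same rule,
    s_{k+1} - s_k is 2 or 1 according to whether k + 1 is a term of s or a
    deletion, which is the hiccup recursion. *)

Import Order.TTheory GRing.Theory Num.Theory.

Local Open Scope classical_set_scope.

(** * The golden sieve on an arbitrary starting sequence *)

Lemma increasing_enumeration_naturals :
  increasing_enumeration (terms naturals) naturals.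
Proof. by split. Qed.

Lemma increasing_enumeration_delete {P X h} : 0 < h ->
  increasing_enumeration P X ->
  increasing_enumeration (P `\ X h) (fun k => X (if k < h then k else k.+1)).
Proof.
move=> h0 [X0 Xlt XP]; split; first by rewrite h0.
  by move=> i j ij; apply: Xlt; case: ifP; case: ifP; lia.
rewrite -XP; apply/seteqP; split=> x /=.
  case=> k /= k0 <-; split; first by case: ifP => _; [exists k | exists k.+1].
  by move/(incn_inj (leq_mono Xlt)); case: ifP; lia.
move=> [[k /= k0 <-] Xk]; have [kh|hk|kh] := ltngtP k h.
- by exists k => //; rewrite kh.
- by exists k.-1 => /=; [lia | case: ifP; [lia | rewrite prednK]].
- by case: Xk; rewrite kh.
Qed.

Lemma increasing_enumeration_ge {P X} : increasing_enumeration P X ->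
  forall n, n <= X n.
Proof.
move=> [X0 Xlt _]; elim=> // n IH.
exact: leq_ltn_trans IH (Xlt _ _ (ltnSn n)).
Qed.

(** This also ensures that every set met by the sieve has an increasing enumeration, so
    [enumeration] never returns its default value there. *)
Lemma increasing_enumeration_sieve {W0 P} n : increasing_enumeration P W0 ->
  increasing_enumeration
    (P `\` [set deletion W0 k | k in [set k | 0 < k <= n]]) (sieve W0 n).
Proof.
move=> W0P; elim: n => [|n IH].
  suff -> : [set k | 0 < k <= 0] = set0 by rewrite image_set0 setD0.
  by apply/seteqP; split=> // k /=; lia.
have h0 := leq_trans (ltn0Sn n) (increasing_enumeration_ge IH n.+1).
have W'P := increasing_enumeration_delete h0 IH.
suff -> : [set k | 0 < k <= n.+1] = [set k | 0 < k <= n] `|` [set n.+1].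
  rewrite image_setU image_set1 -setDDl /=.
  have [_ _ ->] := IH.
  by rewrite (enumerationE W'P).
by apply/seteqP; split=> k /=; [case: (ltngtP k n.+1); lia | case=> [|->]; lia].
Qed.

Lemma sieve_succ {W0 P} n k : increasing_enumeration P W0 ->
  sieve W0 n.+1 k = sieve W0 n (if k < pointer W0 n.+1 then k else k.+1).
Proof.
move=> /(increasing_enumeration_sieve n) WP.
have h0 := leq_trans (ltn0Sn n) (increasing_enumeration_ge WP n.+1).
have [_ _ WE] := WP; rewrite -WE in WP.
by rewrite /= (enumerationE (increasing_enumeration_delete h0 WP)).
Qed.

(** * The sieve of the natural numbers, from the self-referential rule *)

(** The last clause starts at [m = 1]: with [m = 0] and [k = 1] it would force [s 1 = 1]. *)
Definition wythoff_rule (s : nat -> nat) : Prop :=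
  [/\ s 0 = 0, s 1 = 2, {homo s : i j / i < j} &
      forall m k, 0 < m -> s m <= k < s m.+1 -> s k = k + m].

Lemma wythoff_rule_gt s n : wythoff_rule s -> n.+1 < s n.+1.
Proof.
move=> [_ s1 slt _]; elim: n => [|n IH]; first by rewrite s1.
exact: leq_ltn_trans IH (slt _ _ (ltnSn n.+1)).
Qed.

(** When index n + 1 lies in the tail of W_n, its entry is s_{n+1} all the same, so the pointer
    needs no case distinction. *)
Lemma wythoff_rule_pointer s n : wythoff_rule s ->
  0 < n -> s n <= n.+1 -> s n.+1 = n.+1 + n.
Proof.
move=> ss n0 sn; have [_ _ _ srec] := ss.
by rewrite (srec n) // sn wythoff_rule_gt.
Qed.

Lemma sieve_naturalsE s n k : wythoff_rule s ->
  sieve naturals n k = if k < s n then s k else k + n.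
Proof.
move=> ss; have [s0 s1 slt srec] := ss.
elim: n k => [|n IH] k; first by rewrite s0 addn0.
rewrite (sieve_succ _ _ increasing_enumeration_naturals) /pointer /= !IH.
have sn := slt _ _ (ltnSn n).
have [-> | n0] := posnP n.
  by rewrite s0 s1 /=; case: k => [|[|k]] //=; lia.
have -> : (if n.+1 < s n then s n.+1 else n.+1 + n) = s n.+1.
  by case: ltnP => // /(wythoff_rule_pointer _ _ ss n0).
(* For s_n <= k < s_{n+1} the rule identifies the tail entry k + n with s_k; from s_{n+1} on, the
   deletion shifts the tail by one index. *)
have [kn|nk] := ltnP k (s n.+1).
  by case: ltnP => // nk; rewrite (srec n) // nk kn.
by rewrite ltnNge (leq_trans (ltnW sn)) ?leqW //= addSnnS.
Qed.

Lemma deletion_naturalsE s n : wythoff_rule s ->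
  deletion naturals n.+1 = if n is 0 then 1 else s n.+1 + n.
Proof.
move=> ss; have [s0 s1 slt _] := ss.
rewrite /deletion /pointer /= !(sieve_naturalsE s) //.
case: n => [|n]; first by rewrite s0.
have -> : (if n.+2 < s n.+1 then s n.+2 else n.+2 + n.+1) = s n.+2.
  by case: ltnP => // /(wythoff_rule_pointer _ _ ss (ltn0Sn n)).
by rewrite ltnNge ltnW // slt.
Qed.

(** The term s_k lies in W_N for all large N, so it is never deleted. Conversely, an undeleted x
    lies in W_x but not in its tail, whose entries k + x exceed x. *)
Lemma increasing_enumeration_survivor s : wythoff_rule s ->
  increasing_enumeration (terms naturals `\` terms (deletion naturals)) s.
Proof.
move=> ss; have [s0 s1 slt _] := ss; split=> //.
have gts n := increasing_enumeration_ge (And3 s0 slt (erefl (terms s))) n.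
have W n := increasing_enumeration_sieve n increasing_enumeration_naturals.
apply/seteqP; split=> x.
  case=> k /= k0 <-; split; first by exists (s k) => //=; have := gts k; lia.
  case=> n /= n0 dn; set N := maxn n k.+1.
  have : terms (sieve naturals N) (s k).
    exists k => //; rewrite (sieve_naturalsE s) //.
    by case: ltnP => //; have := gts N; rewrite /N; lia.
  have [_ _ ->] := W N; case=> _; apply; exists n => //=.
  by rewrite n0 leq_maxl.
case=> x0 xd.
have : terms (sieve naturals x) x.
  have [_ _ ->] := W x; split=> // -[k /= /andP[k0 _] kx].
  by apply: xd; exists k.
case=> k /= k0; rewrite (sieve_naturalsE s) //; case: ltnP => [_ <-|_].
  by exists k.
by lia.
Qed.

Lemma hiccup0123_deletion s : wythoff_rule s -> hiccup0123 (deletion naturals).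
Proof.
move=> ss; have [s0 s1 slt srec] := ss.
have dE n := deletion_naturalsE s n ss.
have [_ _ sP] := increasing_enumeration_survivor s ss.
have dgt n : 0 < n -> n.+1 < deletion naturals n.+1.
  by rewrite dE; case: n => // n _; have := wythoff_rule_gt s n.+1 ss; lia.
split=> [|[|[|n]]] //.
move=> _; rewrite [n.+2.-1]/=.
(* Deletions of index at least n + 2 exceed n + 2, so the finite list decides whether n + 2 is a
   deletion at all. *)
have inE : (n.+2 \in [seq deletion naturals k | k <- iota 1 n.+1]) =
           `[< terms (deletion naturals) n.+2 >].
  apply/mapP/asboolP => [[k + ->]|[[|[|k]] // _ dk]].
  - by rewrite mem_iota => /andP[k0 _]; exists k.
  - by exists k.+2 => //; rewrite mem_iota; have := dgt k.+1 isT; lia.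
rewrite inE {inE} !dE.
have sn : terms (deletion naturals) n.+2 <-> ~ terms s n.+2.
  rewrite sP; split=> [dn [_]|] //.
  by move=> nd; apply: contrapT => dn; apply: nd; split=> //; exists n.+2.
case: n sn => [|n] sn.
  have -> : s 2 = 3.
    by rewrite (srec 1) //; have := wythoff_rule_gt s 1 ss; rewrite s1; lia.
  by case: asboolP => // /sn []; exists 1.
have ex : exists m, (0 < m) && (s m <= n.+2 < s m.+1).
  have : exists m, n.+2 < s m by exists n.+2; apply: wythoff_rule_gt.
  move=> H; case: (ex_minnP H) => -[|[|m]]; rewrite ?s0 ?s1 // => ltm minm.
  exists m.+1; rewrite ltm andbT /= leqNgt; apply/negP => /minm.
  by lia.
case: ex => m /andP[m0 nm]; rewrite [s n.+2](srec m) //.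
(* Either n + 3 lies strictly between s_m and s_{m+1}, hence is a deletion, and s grows by 1; or n +
   3 = s_{m+1} and s grows by 2. The deletions grow by one more. *)
have [lt_n|ge_n] := ltnP n.+3 (s m.+1).
  rewrite (srec m) //; last by lia.
  case: asboolP => [_|]; first lia.
  move=> /sn nn; case: nn => -[k _ sk].
  have lts := leqW_mono (leq_mono slt).
  have mk : m < k by rewrite -lts sk; lia.
  have km : k < m.+1 by rewrite -lts sk.
  by move: km; rewrite ltnS leqNgt mk.
have smE : s m.+1 = n.+3 by lia.
rewrite (srec m.+1) //; last by rewrite -smE leqnn slt.
by case: asboolP => [/sn []|]; [exists m.+1 | lia].
Qed.

(** * Irrationality of the golden ratio and the closed form *)

(** Infinite descent on the norm j^2 - j m - m^2 of j - m phi: a zero (j, m) with m > 0 yields the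
    smaller zero (m, j - m). *)
Lemma golden_form_eq0 j m : j * j = j * m + m * m -> m = 0.
Proof.
elim/ltn_ind: m j => -[//|m] IH j jm.
have mj : m.+1 < j by nia.
have mm : m.+1 * m.+1 = m.+1 * (j - m.+1) + (j - m.+1) * (j - m.+1) by nia.
by have := IH (j - m.+1) _ m.+1 mm; nia.
Qed.

Local Open Scope ring_scope.

Lemma golden_ratio_sqr {R : realType} :
  golden_ratio R ^+ 2 = golden_ratio R + 1.
Proof.
have : Num.sqrt 5 ^+ 2 = 5 :> R by rewrite sqr_sqrtr.
by rewrite /golden_ratio; lra.
Qed.

Lemma golden_ratio_gt1 {R : realType} : 1 < golden_ratio R.
Proof.
have : 1 < Num.sqrt 5 :> R by rewrite -[ltLHS]sqrtr1 ltr_sqrt ?ltr1n.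
by rewrite /golden_ratio; lra.
Qed.

Lemma golden_ratio_irrational {R : realType} (j m : nat) :
  (0 < m)%N -> j%:R != m%:R * golden_ratio R.
Proof.
move=> m0; apply/eqP => jm.
suff /golden_form_eq0 : (j * j = j * m + m * m)%N by lia.
apply/eqP; rewrite -(eqr_nat R) natrD !natrM jm; apply/eqP.
by rewrite mulrACA -!expr2 golden_ratio_sqr; ring.
Qed.

Definition shifted_lower_wythoff (R : realType) (n : nat) : nat :=
  if n is m.+1 then (`|Num.floor (m%:R * golden_ratio R)| + 2)%N else 0%N.

Lemma shifted_lower_wythoffE (R : realType) (m : nat) :
  (shifted_lower_wythoff R m.+1)%:Z = Num.floor (m%:R * golden_ratio R) + 2.
Proof.
rewrite /= PoszD gez0_abs // floor_ge0 mulr_ge0 //.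
exact/ltW/(lt_trans ltr01 golden_ratio_gt1).
Qed.

Lemma shifted_lower_wythoff_lt (R : realType) (m : nat) :
  (shifted_lower_wythoff R m < shifted_lower_wythoff R m.+1)%N.
Proof.
case: m => [|m]; first by rewrite /= addn2.
rewrite -ltz_nat !shifted_lower_wythoffE ltrD2r -lezD1 floor_ge_int intrD.
have := floor_le (m%:R * golden_ratio R); rewrite -natr1.
by have := @golden_ratio_gt1 R; lra.
Qed.

(** With indices shifted by one, the hypothesis of the rule reads m phi < j < (m + 1) phi, and the
    conclusion floor (j phi) = j + m. *)
Lemma wythoff_rule_shifted_lower_wythoff (R : realType) :
  wythoff_rule (shifted_lower_wythoff R).
Proof.
split=> //=; first by rewrite mul0r floor0.
  exact: (homo_ltn ltn_trans (@shifted_lower_wythoff_lt R)).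
case=> // m [|j] _.
  by have := shifted_lower_wythoff_lt R m; lia.
rewrite -lez_nat -ltz_nat !shifted_lower_wythoffE => /andP[mj jm].
have {}mj : Num.floor (m%:R * golden_ratio R) < j%:Z by lia.
have {}jm : j%:Z <= Num.floor (m.+1%:R * golden_ratio R) by lia.
move: mj jm; rewrite floor_lt_int floor_ge_int -pmulrn => mj jm.
(* Irrationality excludes equality, which would give floor (j phi) = j + m + 1. *)
have {}jm : j%:R < m.+1%:R * golden_ratio R.
  by rewrite lt_neqAle jm golden_ratio_irrational.
suff jE : Num.floor (j%:R * golden_ratio R) = (j + m)%N.
  by apply/eqP; rewrite -eqz_nat shifted_lower_wythoffE jE; lia.
apply: floor_def; rewrite intrD -!pmulrn natrD; move: jm; rewrite -natr1.
have := @golden_ratio_sqr R; have := @golden_ratio_gt1 R.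
(* Multiply both bounds by phi - 1 = 1 / phi. *)
set phi := golden_ratio R in mj *; move=> phi1 phi2 jm.
have phiV : phi * (phi - 1) = 1 by rewrite mulrBr -expr2 phi2; ring.
have phi0 : 0 < phi - 1 by rewrite subr_gt0.
move: mj jm; rewrite -(ltr_pM2r phi0) -mulrA phiV => mj.
by rewrite -(ltr_pM2r phi0) -mulrA phiV => jm; apply/andP; split; lra.
Qed.

Theorem corollary2p10 (R : realType) :
  let phi : R := golden_ratio R in
  let s : nat -> nat := survivor naturals in
  let d : nat -> nat := deletion naturals in
  let A (m : nat) : int := (s m.+1)%:Z - 2 in
  let B (m : nat) : int := (d m.+1)%:Z - 2 in
  [/\ forall n : nat, (1 <= n)%N ->
        (s n)%:Z = Num.floor ((n%:R - 1) * phi) + 2,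
      (forall n : nat, (2 <= n)%N ->
        (d n)%:Z = Num.floor ((n%:R - 1) * phi ^+ 2) + 2) /\ d 1%N = 1%N,
      forall m : nat, (1 <= m)%N ->
        [/\ A m = Num.floor (m%:R * phi),
            B m = Num.floor (m%:R * phi ^+ 2)
          & B m = A m + m%:Z]
    & hiccup0123 d].
Proof.
move=> phi s d A B.
have rule := wythoff_rule_shifted_lower_wythoff R.
have sE m : (s m.+1)%:Z = Num.floor (m%:R * phi) + 2.
  rewrite -shifted_lower_wythoffE; congr Posz; rewrite /s /survivor.
  by rewrite (enumerationE (increasing_enumeration_survivor _ rule)).
have dsE m : (1 <= m)%N -> (d m.+1)%:Z = (s m.+1)%:Z + m%:Z.
  rewrite sE -shifted_lower_wythoffE /d (deletion_naturalsE _ _ rule).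
  by case: m.
(* Since phi^2 = phi + 1, this matches d_{m+1} = s_{m+1} + m. *)
have floor_sqr m :
    Num.floor (m%:R * phi ^+ 2) = Num.floor (m%:R * phi) + m%:Z.
  rewrite golden_ratio_sqr mulrDr mulr1 floorDrz ?natr_int //.
  by rewrite -[m%:R]/(m%:Z%:~R) intrKfloor.
have subn1 n : n.+1%:R - 1 = n%:R :> R by rewrite -natr1 addrK.
split.
- by case=> // n _; rewrite sE subn1.
- split; last by rewrite /d (deletion_naturalsE _ 0 rule).
  by case=> [|[|n]] // _; rewrite dsE // sE subn1 floor_sqr; lia.
- move=> m m1; rewrite /A /B dsE // sE floor_sqr; split; lia.
- exact: hiccup0123_deletion rule.
Qed.
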